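(* Let $n\geq 1$ be an integer, let $f\in\mathcal{A}_n$, let $\alpha$ be a real number with $0\leq\alpha<1$, and let $\beta$ be a complex number with $\mathrm{Re}(\beta)<n+1$. If $$\left|z^2f'''(z)+(2-\beta)zf''(z)\right|<\frac{(1-\alpha)\,n\,|n+1-\beta|}{n+1-\alpha}\qquad\text{for all } z\in\mathbb{U},$$ then $$\left|\left(1+\frac{zf''(z)}{f'(z)}\right)-1\right|<1-\alpha\qquad\text{for all } z\in\mathbb{U},$$ so that $f\in\mathcal{K}(\alpha)$.
   Context: $\mathbb{U}=\{z\in\mathbb{C}:|z|<1\}$ is the open unit disk. For an integer $n\geq1$, $\mathcal{A}_n$ is the class of functions $f$ analytic in $\mathbb{U}$ with power series of the form $f(z)=z+a_{n+1}z^{n+1}+a_{n+2}z^{n+2}+\cdots$. For $0\leq\alpha<1$, $\mathcal{K}(\alpha)$ is the class of $f\in\mathcal{A}_n$ such that $\mathrm{Re}\left(1+\frac{zf''(z)}{f'(z)}\right)>\alpha$ for all $z\in\mathbb{U}$. Inequalities involving a quotient include the assertion that the quotient is defined, i.e. here that $f'(z)\neq0$ for $z\in\mathbb{U}$. *)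

(* Defs.v *)
From Stdlib Require Import Reals.
From Coquelicot Require Export Coquelicot.

Local Open Scope C_scope.

(* Functions on the unit disk are represented by total functions [C -> C], of
   which only the values on [unit_disk] matter: the disk is open, so
   [C_derive f z] with [z] in the disk depends only on those values.
   [C_derive] is total and defined through a directional limit; it is the
   complex derivative wherever [ex_derive f z] holds ([C_derive_correct]),
   hence, together with its iterates, everywhere in the disk when [f] is
   holomorphic there. *)

Definition unit_disk (z : C) : Prop := (Cmod z < 1)%R.

(* Complex differentiability: the scalar field is [C_AbsRing]. *)
Definition analytic_in_disk (f : C -> C) : Prop :=
  forall z : C, unit_disk z -> @ex_derive C_AbsRing C_NormedModule f z.

Definition class_A (n : nat) (f : C -> C) : Prop :=
  analytic_in_disk f /\
  exists a : nat -> C,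
    a 0%nat = 0 /\ a 1%nat = 1 /\
    (forall k : nat, (2 <= k <= n)%nat -> a k = 0) /\
    (forall z : C, unit_disk z ->
       @is_pseries C_AbsRing C_NormedModule a z (f z)).

(* Division by zero is total in [C], so the nonvanishing of [f'] that is
   implicit in the quotient is stated explicitly. *)
Definition class_K (n : nat) (alpha : R) (f : C -> C) : Prop :=
  class_A n f /\
  forall z : C, unit_disk z ->
    C_derive f z <> 0 /\
    (Re (1 + z * C_derive (C_derive f) z / C_derive f z) > alpha)%R.

(* Main.v *)
Require Import Defs.
From Stdlib Require Import Reals Lra Lia List Classical ClassicalChoice.
From Coquelicot Require Import Coquelicot.

(** Since the coefficients of [z^2, ..., z^n] vanish, [f' z = 1 + z^n p(z)] with [p] holomorphic in
    the disk. Differentiating twice more and multiplying by [z] each time,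
      [z f'' z = z^n h(z)] with [h = z p' + n p], and
      [z^2 f''' z + (2 - beta) z f'' z = z^n H(z)] with [H = z h' + g h], [g = n + 1 - beta].
    The operators [F |-> z F' + g F] with [Re g > 0] can be inverted with a sharp bound: if
    [|z F' + g F| <= M] in the disk, then [|g| |F| <= M] ([euler_operator_bound]). At a point where
    [|F|] is maximal on a closed disk about the origin, the first order condition in a well chosen
    inward direction shows that the two terms of [z F' + g F] do not work against each other. This
    plays the part that Jack's lemma often plays in such results.

    Put [N = (1 - alpha) n / (n + 1 - alpha)]. The hypothesis says [|z^n H| < N |g|], so [|H| <= N |g|]
    by Schwarz's lemma ([schwarz_division]). Inverting the operator for [g] gives [|h| <= N], and
    inverting it for [n] gives [n |p| <= N]. With [rho = |z|^n < 1] this means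
    [|z f'' z| <= rho N] and [|f' z| >= 1 - rho N / n]. As [N + (1 - alpha) N / n = 1 - alpha], the
    first is smaller than [1 - alpha] times the second, which gives both that [f' z] does not vanish
    and the bound on the quotient.

    Schwarz's lemma rests on the maximum modulus principle, proved here by perturbing [|F|^2] to
    the strictly subharmonic [|F|^2 + eps |z|^2] ([no_interior_max]). All functions involved are sums
    of power series in the disk, a class closed under differentiation
    ([is_derive_disk_pseries]), so that the second derivatives needed there exist. *)

Local Open Scope C_scope.

Local Notation is_C_derive := (@is_derive C_AbsRing C_NormedModule).
Local Notation is_C_series := (@is_series C_AbsRing C_NormedModule).
Local Notation is_C_pseries := (@is_pseries C_AbsRing C_NormedModule).

(** * Complex power series on the unit disk *)

Lemma pow_n_Cpow (z : C) (k : nat) : @pow_n C_Ring z k = z ^ k.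
Proof. induction k as [|k IH]; [reflexivity | now simpl; rewrite <- IH]. Qed.

Lemma Cmod_le_add_dist (z w : C) : (Cmod w <= Cmod z + Cmod (w - z))%R.
Proof. replace w with (z + (w - z)) at 1 by ring. apply Cmod_triangle. Qed.

Lemma is_pseries_C (a : nat -> C) (z l : C) :
  is_C_pseries a z l <-> is_C_series (fun k => z ^ k * a k) l.
Proof.
  unfold is_pseries.
  split; apply is_series_ext; intros k; rewrite <- pow_n_Cpow; reflexivity.
Qed.

Lemma Cmod_series_le (u : nat -> C) (v : nat -> R) (l : C) :
  is_C_series u l ->
  (forall k, Cmod (u k) <= v k)%R -> ex_series v ->
  (Cmod l <= Series v)%R.
Proof.
  intros Hu Huv Hv.
  apply (filterlim_le (F := eventually) (fun n => Cmod (sum_n u n)) (sum_n v)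
           (Finite (Cmod l)) (Finite (Series v))).
  - exists 0%nat. intros n _. induction n as [|n IH].
    + rewrite !sum_O. apply Huv.
    + rewrite !sum_Sn. eapply Rle_trans; [apply Cmod_triangle|].
      apply Rplus_le_compat; [exact IH | apply Huv].
  - apply filterlim_comp with (1 := Hu).
    exact (@filterlim_norm C_AbsRing C_NormedModule l).
  - exact (Series_correct v Hv).
Qed.

Lemma series_terms_bounded (u : nat -> C) (l : C) :
  is_C_series u l ->
  exists M : R, forall k, (Cmod (u k) <= M)%R.
Proof.
  intros Hu.
  destruct (filterlim_bounded (K := C_AbsRing) (V := C_NormedModule) (sum_n u))
    as [M HM]; [now exists l |].
  exists (M + M)%R. intros k.
  assert (H0 : forall m, (Cmod (sum_n u m) <= M)%R) by exact HM.
  destruct k as [|k].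
  - generalize (H0 0%nat) (Cmod_ge_0 (u 0%nat)). rewrite sum_O. lra.
  - replace (u (S k)) with (sum_n u (S k) + - sum_n u k).
    + eapply Rle_trans; [apply Cmod_triangle|]. rewrite Cmod_opp.
      now apply Rplus_le_compat.
    + rewrite sum_Sn. change (@eq C (sum_n u k + u (S k) + - sum_n u k) (u (S k))). ring.
Qed.

Definition disk_expansion (a : nat -> C) (F : C -> C) : Prop :=
  forall z, unit_disk z -> is_C_pseries a z (F z).

(** Stated through the moduli so that the theory of radii of convergence of real power
    series, including that of the derived series, carries over to complex coefficients. *)
Definition disk_coefs (a : nat -> C) : Prop :=
  forall r : R, (0 <= r < 1)%R -> Rbar_lt r (CV_radius (fun k => Cmod (a k))).

(** Convergence at a real point [s] with [r < s < 1] bounds the terms [a k * s ^ k], hence the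
    radius of convergence is at least [s]. *)
Lemma disk_coefs_of_pseries (F : C -> C) (a : nat -> C) :
  disk_expansion a F -> disk_coefs a.
Proof.
  intros HF r Hr.
  set (s := ((r + 1) / 2)%R).
  assert (Hs : (r < s < 1)%R) by (unfold s; lra).
  apply Rbar_lt_le_trans with (Finite s); [simpl; lra |].
  destruct (series_terms_bounded (fun k => RtoC s ^ k * a k) (F (RtoC s))) as [M HM].
  - apply is_pseries_C, HF. unfold unit_disk. rewrite Cmod_R, Rabs_pos_eq; lra.
  - apply (proj1 (CV_radius_bounded (fun k => Cmod (a k)))).
    exists M. intros k. specialize (HM k).
    rewrite Cmod_mult, Cmod_pow, Cmod_R, (Rabs_pos_eq s) in HM by lra.
    rewrite Rabs_pos_eq; [lra |].
    apply Rmult_le_pos; [apply Cmod_ge_0 | apply pow_le; lra].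
Qed.

Lemma disk_coefs_summable (a : nat -> C) (r : R) :
  disk_coefs a -> (0 <= r < 1)%R -> ex_series (fun k => Cmod (a k) * r ^ k)%R.
Proof.
  intros Ha Hr.
  assert (H : Rbar_lt (Rabs r) (CV_radius (fun k => Cmod (a k)))).
  { rewrite Rabs_pos_eq by lra. now apply Ha. }
  apply CV_radius_inside in H. revert H.
  apply ex_series_ext. intros k. unfold scal; simpl. unfold mult; simpl.
  now rewrite pow_n_pow, Rmult_comm.
Qed.

Lemma disk_coefs_ex_pseries (a : nat -> C) (z : C) :
  disk_coefs a -> unit_disk z -> ex_pseries (K := C_AbsRing) (V := C_NormedModule) a z.
Proof.
  intros Ha Hz.
  apply (ex_series_le (K := C_AbsRing) (V := C_CompleteNormedModule) _
           (fun k => Cmod (a k) * Cmod z ^ k)%R).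
  - intros k. change (Cmod (@pow_n C_Ring z k * a k) <= Cmod (a k) * Cmod z ^ k)%R.
    rewrite pow_n_Cpow, Cmod_mult, Cmod_pow. lra.
  - apply disk_coefs_summable; [exact Ha |]. split; [apply Cmod_ge_0 | exact Hz].
Qed.

Definition coefs_derive (a : nat -> C) (k : nat) : C := RtoC (INR (S k)) * a (S k).

Lemma disk_coefs_derive (a : nat -> C) : disk_coefs a -> disk_coefs (coefs_derive a).
Proof.
  intros Ha r Hr.
  rewrite (CV_radius_ext _ (PS_derive (fun k => Cmod (a k)))).
  - rewrite CV_radius_derive. now apply Ha.
  - intros k. unfold coefs_derive, PS_derive.
    rewrite Cmod_mult, Cmod_R, Rabs_pos_eq; [reflexivity | apply pos_INR].
Qed.

(** The error [e k] of the linear approximation of [w ^ k] satisfies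
    [e (S k) = w * e k + k * z ^ (k - 1) * (w - z) ^ 2], which gives a bound quadratic in [w - z]
    whose coefficients are those of a twice derived power series. *)
Lemma pow_linear_error (rho : R) (z w : C) (k : nat) :
  (Cmod z <= rho)%R -> (Cmod w <= rho)%R ->
  (Cmod (w ^ k - z ^ k - RtoC (INR k) * z ^ pred k * (w - z))
   <= INR k * INR (pred k) * rho ^ (k - 2) * Cmod (w - z) ^ 2)%R.
Proof.
  intros Hz Hw. induction k as [|k IH].
  - simpl. replace (1 - 1 - 0 * 1 * (w - z)) with (RtoC 0) by ring.
    rewrite Cmod_0. lra.
  - replace (w ^ S k - z ^ S k - RtoC (INR (S k)) * z ^ pred (S k) * (w - z))
      with (w * (w ^ k - z ^ k - RtoC (INR k) * z ^ pred k * (w - z))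
            + (RtoC (INR k) * z ^ pred k) * ((w - z) * (w - z))).
    2: { rewrite S_INR, RtoC_plus. destruct k as [|k]; simpl; ring. }
    eapply Rle_trans; [apply Cmod_triangle|].
    rewrite !Cmod_mult, Cmod_pow, Cmod_R, (Rabs_pos_eq _ (pos_INR k)).
    assert (H0 := Cmod_ge_0 z). assert (H1 := Cmod_ge_0 w).
    set (D := Cmod (w - z)) in *. assert (HD : (0 <= D ^ 2)%R) by apply pow2_ge_0.
    destruct k as [|k].
    + simpl in *. nra.
    + replace (S (S k) - 2)%nat with k by lia.
      simpl Nat.pred in *.
      assert (Hp : (Cmod z ^ k <= rho ^ k)%R) by (apply pow_incr; lra).
      assert (Hi := pos_INR k).
      assert (HI : (rho * (INR (S k) * INR k * rho ^ (S k - 2) * D ^ 2)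
                 = INR (S k) * INR k * rho ^ k * D ^ 2)%R).
      { destruct k as [|k]; [simpl; ring|].
        replace (S (S k) - 2)%nat with k by lia. simpl pow. ring. }
      assert (HA : (Cmod w * Cmod (w ^ S k - z ^ S k - INR (S k) * z ^ k * (w - z))
               <= INR (S k) * INR k * rho ^ k * D ^ 2)%R).
      { rewrite <- HI. apply Rmult_le_compat; auto using Cmod_ge_0. }
      assert (HB : (INR (S k) * Cmod z ^ k * (D * D) <= INR (S k) * rho ^ k * D ^ 2)%R).
      { replace (D * D)%R with (D ^ 2)%R by ring.
        apply Rmult_le_compat_r; [exact HD|]. apply Rmult_le_compat_l; [apply pos_INR| exact Hp]. }
      eapply Rle_trans; [apply Rplus_le_compat; [exact HA | exact HB]|].
      assert (Hn : (0 <= INR (S k) * rho ^ k * D ^ 2)%R).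
      { apply Rmult_le_pos; [|exact HD]. apply Rmult_le_pos; [apply pos_INR | apply pow_le; lra]. }
      rewrite (S_INR (S k)).
      assert (H5 : (INR (S k) = INR k + 1)%R) by apply S_INR.
      rewrite H5 in *. nra.
Qed.

Lemma is_derive_C_of_quadratic (F : C -> C) (z l : C) (d K : R) :
  (0 < d)%R ->
  (forall w, Cmod (w - z) < d -> Cmod (F w - F z - l * (w - z)) <= K * Cmod (w - z) ^ 2)%R ->
  is_C_derive F z l.
Proof.
  intros Hd HF. split.
  - apply (is_linear_scal_l (K := C_AbsRing) (V := C_NormedModule)).
  - intros x Hx. rewrite <- (is_filter_lim_locally_unique _ _ Hx). clear x Hx.
    intros eps.
    assert (Hm : (0 < Rmin d (eps / (Rabs K + 1)))%R).
    { apply Rmin_glb_lt; [exact Hd|]. apply Rdiv_lt_0_compat; [apply cond_pos|].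
      generalize (Rabs_pos K); lra. }
    exists (mkposreal _ Hm). intros w Hw.
    change (Cmod (w - z) < Rmin d (eps / (Rabs K + 1)))%R in Hw.
    change (Cmod (F w - F z - (w - z) * l) <= eps * Cmod (w - z))%R.
    rewrite (Cmult_comm _ l).
    assert (H1 : (Cmod (w - z) < d)%R) by (eapply Rlt_le_trans; [exact Hw | apply Rmin_l]).
    assert (H2 : (Cmod (w - z) < eps / (Rabs K + 1))%R)
      by (eapply Rlt_le_trans; [exact Hw | apply Rmin_r]).
    eapply Rle_trans; [apply HF, H1|].
    assert (H0 := Cmod_ge_0 (w - z)). assert (HK := Rabs_pos K). assert (HK' := Rle_abs K).
    replace (K * Cmod (w - z) ^ 2)%R with (K * Cmod (w - z) * Cmod (w - z))%R by ring.
    apply Rmult_le_compat_r; [exact H0|].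
    apply Rmult_lt_compat_r with (r := (Rabs K + 1)%R) in H2; [|lra].
    unfold Rdiv in H2. rewrite Rmult_assoc, Rinv_l, Rmult_1_r in H2 by lra. nra.
Qed.

(** Termwise differentiation. Summing the quadratic errors of the powers against [a] on a disk of
    radius [rho < 1] that contains a neighbourhood of [z] gives a quadratic error for [F], since
    the twice derived series of moduli converges at [rho]. *)
Lemma is_derive_disk_pseries (F : C -> C) (a : nat -> C) (z l : C) :
  disk_expansion a F ->
  unit_disk z ->
  is_C_pseries (coefs_derive a) z l ->
  is_C_derive F z l.
Proof.
  intros HF Hz HG.
  set (rho := ((Cmod z + 1) / 2)%R).
  assert (H0 := Cmod_ge_0 z). unfold unit_disk in Hz.
  assert (Hrho : (Cmod z < rho < 1)%R) by (unfold rho; lra).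
  set (v := fun k => (Cmod (a k) * (INR k * INR (pred k) * rho ^ (k - 2)))%R).
  assert (Hv : ex_series v).
  { apply (ex_series_incr_n v 2).
    assert (H := disk_coefs_summable _ rho
             (disk_coefs_derive _ (disk_coefs_derive _ (disk_coefs_of_pseries F a HF)))).
    assert (Hr : (0 <= rho < 1)%R) by lra. specialize (H Hr). revert H.
    apply ex_series_ext. intros k. unfold v, coefs_derive.
    match goal with |- @eq _ ?x ?y => change (@eq R x y) end.
    rewrite !Cmod_mult, !Cmod_R, !(Rabs_pos_eq (INR _)) by apply pos_INR.
    replace (2 + k - 2)%nat with k by lia. simpl Nat.pred. simpl Nat.add.
    change (INR (S (S k))) with (INR (S k) + 1)%R. simpl Nat.add. ring. }
  apply is_derive_C_of_quadratic with (d := (rho - Cmod z)%R) (K := Series v); [lra|].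
  intros w Hw.
  assert (Hw' : (Cmod w <= rho)%R).
  { assert (T := Cmod_le_add_dist z w). lra. }
  rewrite Rmult_comm. rewrite <- Series_scal_l.
  apply Cmod_series_le with
    (u := fun k => a k * (w ^ k - z ^ k - RtoC (INR k) * z ^ pred k * (w - z))).
  - assert (HFw : unit_disk w) by (unfold unit_disk; lra).
    apply HF in HFw. assert (HFz := HF z Hz).
    apply is_pseries_C in HFw. apply is_pseries_C in HFz. apply is_pseries_C in HG.
    assert (HG' : is_C_series
              (fun k => RtoC (INR k) * z ^ pred k * a k) l).
    { apply is_series_decr_1.
      replace (plus l _) with l.
      - revert HG. apply is_series_ext. intros k. unfold coefs_derive.
        change (@eq C (z ^ k * (RtoC (INR (S k)) * a (S k)))
                   (RtoC (INR (S k)) * z ^ k * a (S k))). ring.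
      - change (@eq C l (l + - (RtoC (INR 0) * z ^ pred 0 * a 0%nat))). simpl. ring. }
    apply (is_series_scal (K := C_AbsRing) (V := C_NormedModule) (w - z)) in HG'.
    assert (H := is_series_minus _ _ _ _ (is_series_minus _ _ _ _ HFw HFz) HG').
    replace (F w - F z - l * (w - z)) with
      (plus (plus (F w) (opp (F z))) (opp (scal (w - z) l))).
    + revert H. apply is_series_ext. intros k.
      change (@eq C (w ^ k * a k + - (z ^ k * a k) + - ((w - z) * (RtoC (INR k) * z ^ pred k * a k)))
              (a k * (w ^ k - z ^ k - RtoC (INR k) * z ^ pred k * (w - z)))). ring.
    + change (@eq C (F w + - F z + - ((w - z) * l)) (F w - F z - l * (w - z))). ring.
  - intros k. rewrite Cmod_mult. unfold v.
    replace (Cmod (w - z) ^ 2 * (Cmod (a k) * (INR k * INR (Nat.pred k) * rho ^ (k - 2))))%R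
      with (Cmod (a k) * (INR k * INR (Nat.pred k) * rho ^ (k - 2) * Cmod (w - z) ^ 2))%R by ring.
    apply Rmult_le_compat_l; [apply Cmod_ge_0|].
    apply pow_linear_error; lra.
  - now apply (ex_series_scal (K := R_AbsRing) (V := R_NormedModule)).
Qed.

(** The holomorphic functions of this proof: working with expansions makes all derivatives
    available without Cauchy's theory. *)
Definition disk_series (F : C -> C) : Prop :=
  exists a : nat -> C, disk_expansion a F.

Lemma disk_expansion_derive (F : C -> C) (a : nat -> C) :
  disk_expansion a F ->
  disk_expansion (coefs_derive a) (C_derive F) /\
  forall z, unit_disk z -> is_C_derive F z (C_derive F z).
Proof.
  intros HF.
  assert (H : forall z, unit_disk z ->
     is_C_pseries (coefs_derive a) z (C_derive F z) /\
     is_C_derive F z (C_derive F z)).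
  { intros z Hz.
    destruct (disk_coefs_ex_pseries (coefs_derive a) z) as [l Hl]; [|exact Hz|].
    { eapply disk_coefs_derive, disk_coefs_of_pseries, HF. }
    assert (Hd := is_derive_disk_pseries F a z l HF Hz Hl).
    now rewrite (is_C_derive_unique _ _ _ Hd). }
  split; intros z Hz; now apply H.
Qed.

Lemma disk_series_derive (F : C -> C) :
  disk_series F ->
  disk_series (C_derive F) /\
  forall z, unit_disk z -> is_C_derive F z (C_derive F z).
Proof.
  intros [a HF]. destruct (disk_expansion_derive F a HF) as [H1 H2].
  split; [now exists (coefs_derive a) | exact H2].
Qed.

Lemma disk_series_plus (F G : C -> C) :
  disk_series F -> disk_series G -> disk_series (fun z => F z + G z).
Proof.
  intros [a HF] [b HG]. exists (PS_plus a b). intros z Hz.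
  apply (is_pseries_plus a b z (F z) (G z)); auto.
Qed.

Lemma disk_series_scal (c : C) (F : C -> C) :
  disk_series F -> disk_series (fun z => c * F z).
Proof.
  intros [a HF]. exists (PS_scal c a). intros z Hz.
  apply (is_pseries_scal c a z (F z)); [apply Cmult_comm | auto].
Qed.

Lemma disk_series_id_mult (F : C -> C) :
  disk_series F -> disk_series (fun z => z * F z).
Proof.
  intros [a HF]. exists (PS_incr_1 a). intros z Hz.
  now apply (is_pseries_incr_1 a z (F z)), HF.
Qed.

Lemma disk_coefs_shift (a : nat -> C) (m : nat) :
  disk_coefs a -> disk_coefs (fun k => a (m + k)%nat).
Proof.
  intros Ha. induction m as [|m IH]; [exact Ha|].
  intros r Hr. specialize (IH r Hr). rewrite <- CV_radius_decr_1 in IH.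
  rewrite (CV_radius_ext _ (PS_decr_1 (fun k => Cmod (a (m + k)%nat)))); [exact IH|].
  intros k. unfold PS_decr_1. do 2 f_equal. lia.
Qed.

Lemma disk_coefs_sum (a : nat -> C) :
  disk_coefs a -> exists F : C -> C, disk_expansion a F.
Proof.
  intros Ha.
  apply (choice (fun z l => unit_disk z -> is_C_pseries a z l)).
  intros z. destruct (classic (unit_disk z)) as [Hz|Hz].
  - destruct (disk_coefs_ex_pseries a z Ha Hz) as [l Hl]. now exists l.
  - now exists (RtoC 0).
Qed.

Lemma sum_n_first (u : nat -> C) (m : nat) :
  (forall k, (1 <= k <= m)%nat -> u k = 0) -> sum_n u m = u 0%nat.
Proof.
  intros Hu. induction m as [|m IH]; [apply sum_O|].
  rewrite sum_Sn, IH by (intros k Hk; apply Hu; lia). rewrite (Hu (S m)) by lia.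
  apply (plus_zero_r (u 0%nat)).
Qed.

(** A gap in the expansion lets a power of the variable be factored out, the cofactor again being
    holomorphic, in particular at the origin. *)
Lemma disk_series_gap (F : C -> C) (a : nat -> C) (n : nat) :
  (1 <= n)%nat ->
  disk_expansion a F ->
  (forall k, (1 <= k < n)%nat -> a k = 0) ->
  exists G, disk_series G /\ forall z, unit_disk z -> F z = a 0%nat + z ^ n * G z.
Proof.
  intros Hn HF Ha.
  destruct (disk_coefs_sum (fun k => a (n + k)%nat)) as [G HG].
  { eapply disk_coefs_shift, disk_coefs_of_pseries, HF. }
  exists G. split; [now eexists; exact HG|]. intros z Hz.
  specialize (HF z Hz). specialize (HG z Hz). apply is_pseries_C in HF. apply is_pseries_C in HG.
  apply (filterlim_locally_unique (F := eventually) (K := C_AbsRing) (V := C_NormedModule) _ _ _ HF).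
  apply (is_series_decr_n (fun k => z ^ k * a k) n); [lia|].
  apply (is_series_scal (K := C_AbsRing) (V := C_NormedModule) (z ^ n)) in HG.
  replace (plus _ _) with (scal (z ^ n) (G z)).
  - revert HG. apply is_series_ext. intros k.
    change (@eq C (z ^ n * (z ^ k * a (n + k)%nat)) (z ^ (n + k) * a (n + k)%nat)).
    rewrite Cpow_add_r. ring.
  - rewrite sum_n_first.
    + change (@eq C (z ^ n * G z) (a 0%nat + z ^ n * G z + - (z ^ 0 * a 0%nat))). simpl. ring.
    + intros k Hk. rewrite Ha by lia. ring.
Qed.

(** * Complex derivatives *)

(** [C] is a normed module over itself in two ways, with the same norm but with balls of different
    shapes; the product rules are stated for the one, [C_derive] for the other. *)
Lemma is_derive_C_AbsRing (F : C -> C) (z l : C) :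
  is_C_derive F z l <->
  @is_derive C_AbsRing (AbsRing_NormedModule C_AbsRing) F z l.
Proof.
  split; intros [[H1 H2 H3] H]; (split; [constructor; assumption | exact H]).
Qed.

Lemma is_derive_C_id (z : C) : is_C_derive (fun w => w) z (RtoC 1).
Proof.
  apply is_derive_C_of_quadratic with (d := 1%R) (K := 0%R); [lra|].
  intros w _. replace (w - z - 1 * (w - z)) with (RtoC 0) by ring. rewrite Cmod_0. lra.
Qed.

Lemma is_derive_C_pow_mult (G : C -> C) (z l : C) (m : nat) :
  is_C_derive G z l ->
  is_C_derive (fun w => w ^ m * G w) z
    (RtoC (INR m) * z ^ pred m * G z + z ^ m * l).
Proof.
  intros HG.
  assert (Hp : is_C_derive (fun w => w ^ m) z (RtoC (INR m) * z ^ pred m)).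
  { apply is_derive_C_of_quadratic with (d := 1%R)
      (K := (INR m * INR (pred m) * (Cmod z + 1) ^ (m - 2))%R); [lra|].
    intros w Hw. apply pow_linear_error; [lra|].
    assert (T := Cmod_le_add_dist z w). lra. }
  apply is_derive_C_AbsRing. apply is_derive_C_AbsRing in Hp, HG.
  exact (is_derive_mult _ _ _ _ _ Hp HG Cmult_comm).
Qed.

Lemma is_derive_C_disk_ext (F G : C -> C) (z l : C) :
  (forall w, unit_disk w -> F w = G w) -> unit_disk z ->
  is_C_derive F z l -> is_C_derive G z l.
Proof.
  intros HFG Hz. apply is_derive_ext_loc. unfold unit_disk in Hz.
  assert (Hd : (0 < 1 - Cmod z)%R) by lra.
  exists (mkposreal _ Hd). intros w Hw. change (Cmod (w - z) < 1 - Cmod z)%R in Hw.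
  apply HFG. unfold unit_disk.
  assert (T := Cmod_le_add_dist z w). lra.
Qed.

(** Multiplying the derivative by [z] removes the exponent [m - 1], so that all values of [m] are
    treated alike; the operators [z * G' + m * G] produced here are those that
    [euler_operator_bound] inverts. *)
Lemma C_derive_monomial_mult (F G : C -> C) (c : C) (m : nat) :
  disk_series G ->
  (forall w, unit_disk w -> F w = c + w ^ m * G w) ->
  forall z, unit_disk z ->
    z * C_derive F z = z ^ m * (z * C_derive G z + RtoC (INR m) * G z).
Proof.
  intros HG HF z Hz.
  destruct (disk_series_derive G HG) as [_ HD].
  assert (H : is_C_derive F z
    (plus (RtoC 0) (RtoC (INR m) * z ^ pred m * G z + z ^ m * C_derive G z))).
  { apply (is_derive_C_disk_ext (fun w => plus c (w ^ m * G w))); [|exact Hz|].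
    - intros w Hw. symmetry. now apply HF.
    - apply (is_derive_plus (K := C_AbsRing) (V := C_NormedModule) (fun _ => c)).
      + exact (is_derive_const (K := C_AbsRing) (V := C_NormedModule) c z).
      + apply is_derive_C_pow_mult, HD, Hz. }
  rewrite (is_C_derive_unique _ _ _ H).
  change (z * (0 + (RtoC (INR m) * z ^ pred m * G z + z ^ m * C_derive G z))
    = z ^ m * (z * C_derive G z + RtoC (INR m) * G z)).
  destruct m as [|m]; simpl Nat.pred; [simpl; ring|].
  change (z ^ S m) with (z * z ^ m). ring.
Qed.

Lemma is_derive_C_eps (F : C -> C) (z l : C) :
  is_C_derive F z l ->
  forall eps : R, (0 < eps)%R -> exists d : R, (0 < d)%R /\
    forall w, (Cmod (w - z) < d)%R ->
      (Cmod (F w - F z - l * (w - z)) <= eps * Cmod (w - z))%R.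
Proof.
  intros [_ H] eps Heps.
  destruct (H z (fun P HP => HP) (mkposreal eps Heps)) as [d Hd].
  exists d. split; [apply cond_pos|]. intros w Hw.
  rewrite (Cmult_comm l). exact (Hd w Hw).
Qed.

Lemma is_derive_C_continuous (F : C -> C) (z l : C) :
  is_C_derive F z l ->
  forall eps : R, (0 < eps)%R -> exists d : R, (0 < d)%R /\
    forall w, (Cmod (w - z) < d)%R -> (Cmod (F w - F z) < eps)%R.
Proof.
  intros H eps Heps.
  destruct (is_derive_C_eps F z l H 1 Rlt_0_1) as (d & Hd & HF).
  assert (Hl := Cmod_ge_0 l).
  exists (Rmin d (eps / (Cmod l + 1))). split.
  - apply Rmin_glb_lt; [exact Hd|]. apply Rdiv_lt_0_compat; lra.
  - intros w Hw.
    assert (H1 := Rlt_le_trans _ _ _ Hw (Rmin_l _ _)).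
    assert (H2 := Rlt_le_trans _ _ _ Hw (Rmin_r _ _)).
    apply Rlt_div_r in H2; [|lra].
    specialize (HF w H1).
    replace (F w - F z) with ((F w - F z - l * (w - z)) + l * (w - z)) by ring.
    eapply Rle_lt_trans; [apply Cmod_triangle|]. rewrite Cmod_mult. lra.
Qed.

(** * Squared moduli along real lines *)

(** The real inner product of the plane: the squared modulus is its diagonal, and its derivative along
    a line is given by a product rule. *)
Definition dot (x y : C) : R := (Re x * Re y + Im x * Im y)%R.

Lemma dot_self (x : C) : dot x x = (Cmod x ^ 2)%R.
Proof. rewrite Cmod2_alt. unfold dot. ring. Qed.

(** The chain rule across scalar fields: a function differentiable over [C], restricted to a real
    line. *)
Lemma is_derive_line (F : C -> C) (c e l : C) (t : R) :
  is_C_derive F (c + t * e) l ->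
  is_derive (fun s : R => Re (F (c + s * e))) t (Re (l * e)) /\
  is_derive (fun s : R => Im (F (c + s * e))) t (Im (l * e)).
Proof.
  intros H.
  assert (HC : forall eps : R, (0 < eps)%R -> exists d : posreal, forall h : R,
    h <> 0%R -> (Rabs h < d)%R ->
    (Cmod ((F (c + RtoC (t + h) * e)%C - F (c + t * e)%C) / h - l * e) < eps)%R).
  { intros eps Heps. assert (He := Cmod_ge_0 e).
    assert (Heps' : (0 < eps / (Cmod e + 1))%R) by (apply Rdiv_lt_0_compat; lra).
    destruct (is_derive_C_eps F _ l H _ Heps') as (d & Hd & HF).
    assert (Hd' : (0 < d / (Cmod e + 1))%R) by (apply Rdiv_lt_0_compat; lra).
    exists (mkposreal _ Hd'). intros h Hh0 Hh. simpl in Hh.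
    assert (HhC : RtoC h <> 0) by (intros E; apply Hh0; now injection E).
    specialize (HF (c + RtoC (t + h) * e)).
    replace (c + RtoC (t + h) * e - (c + t * e)) with (h * e) in HF
      by (rewrite RtoC_plus; ring).
    rewrite Cmod_mult, Cmod_R in HF.
    assert (Hsmall : (Rabs h * Cmod e < d)%R).
    { apply Rlt_div_r in Hh; [|lra].
      assert (H1 := Rabs_pos h). nra. }
    specialize (HF Hsmall).
    replace ((F (c + RtoC (t + h) * e) - F (c + t * e)) / h - l * e)
      with ((F (c + RtoC (t + h) * e) - F (c + t * e) - l * (h * e)) / h)
      by (field; exact HhC).
    rewrite Cmod_div by exact HhC. rewrite Cmod_R.
    assert (Hh1 : (0 < Rabs h)%R) by now apply Rabs_pos_lt.
    apply Rmult_lt_reg_r with (Rabs h); [exact Hh1|].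
    unfold Rdiv at 1. rewrite Rmult_assoc, Rinv_l, Rmult_1_r by lra.
    eapply Rle_lt_trans; [exact HF|].
    replace (eps / (Cmod e + 1) * (Rabs h * Cmod e))%R
      with (eps * Rabs h * (Cmod e / (Cmod e + 1)))%R by (field; lra).
    assert (Hlt : (Cmod e / (Cmod e + 1) < 1)%R).
    { apply Rmult_lt_reg_r with (Cmod e + 1)%R; [lra|].
      unfold Rdiv. rewrite Rmult_assoc, Rinv_l by lra. lra. }
    assert (0 < eps * Rabs h)%R by now apply Rmult_lt_0_compat. nra. }
  split; apply is_derive_Reals; intros eps Heps;
    destruct (HC eps Heps) as [d Hd]; exists d; intros h Hh0 Hh;
    (eapply Rle_lt_trans; [|exact (Hd h Hh0 Hh)]).
  - eapply Rle_trans; [|apply re_le_Cmod]. right. f_equal.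
    unfold Cdiv, Rdiv. rewrite <- RtoC_inv by exact Hh0.
    unfold Re, Im; simpl. ring.
  - eapply Rle_trans; [|eapply Rle_trans; [apply Rmax_r|apply Rmax_Cmod]]. right. f_equal.
    unfold Cdiv, Rdiv. rewrite <- RtoC_inv by exact Hh0.
    unfold Re, Im; simpl. ring.
Qed.

Lemma is_derive_dot_line (F G : C -> C) (c e l m : C) (t : R) :
  is_C_derive F (c + t * e) l ->
  is_C_derive G (c + t * e) m ->
  is_derive (fun s : R => dot (F (c + s * e)) (G (c + s * e))) t
    (dot (l * e) (G (c + t * e)%C) + dot (F (c + t * e)%C) (m * e))%R.
Proof.
  intros HF HG.
  destruct (is_derive_line F c e l t HF) as [F1 F2].
  destruct (is_derive_line G c e m t HG) as [G1 G2].
  assert (H1 := Derive.is_derive_mult _ _ _ _ _ F1 G1).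
  assert (H2 := Derive.is_derive_mult _ _ _ _ _ F2 G2).
  assert (H := is_derive_plus _ _ _ _ _ H1 H2).
  unfold dot.
  match goal with |- is_derive _ _ ?x => replace x with
    (plus (Re (l * e) * Re (G (c + t * e)%C) + Re (F (c + t * e)%C) * Re (m * e))%R
          (Im (l * e) * Im (G (c + t * e)%C) + Im (F (c + t * e)%C) * Im (m * e))%R) end.
  - exact H.
  - unfold plus; simpl. ring.
Qed.

(** * Maxima on closed disks *)

(** If no point were a maximum, each point would have a neighbourhood on which [u] is beaten by a
    single value of [u]; the best of finitely many such values would beat itself. *)
Lemma continuous_closed_disk_max (u : C -> R) (r : R) :
  (0 <= r)%R ->
  (forall z, (Cmod z <= r)%R -> forall eps, (0 < eps)%R -> exists d, (0 < d)%R /\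
     forall w, (Cmod (w - z) < d)%R -> (Rabs (u w - u z) < eps)%R) ->
  exists z0, (Cmod z0 <= r)%R /\ forall w, (Cmod w <= r)%R -> (u w <= u z0)%R.
Proof.
  intros Hr Hu. apply NNPP. intros Hno.
  assert (Hbeat : forall z : C, exists d : posreal, exists y : C, (Cmod y <= r)%R /\
    forall w, (Rabs (Re w - Re z) < d)%R -> (Rabs (Im w - Im z) < d)%R ->
      (Cmod w <= r)%R -> (u w < u y)%R).
  { assert (Hbeat' : forall z : C, exists d, (0 < d)%R /\ exists y : C, (Cmod y <= r)%R /\
      forall w, (Cmod (w - z) < d)%R -> (Cmod w <= r)%R -> (u w < u y)%R).
    { intros z. destruct (Rle_lt_dec (Cmod z) r) as [Hz|Hz].
      - assert (Hy : exists y, (Cmod y <= r)%R /\ (u z < u y)%R).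
        { apply NNPP. intros Hy. apply Hno. exists z. split; [exact Hz|].
          intros w Hw. apply Rnot_lt_le. intros Hlt. apply Hy. now exists w. }
        destruct Hy as (y & Hy & Hlt).
        destruct (Hu z Hz (u y - u z)%R) as (d & Hd & Hcont); [lra|].
        exists d. split; [exact Hd|]. exists y. split; [exact Hy|].
        intros w Hw _. specialize (Hcont w Hw).
        apply Rabs_lt_between in Hcont. lra.
      - exists (Cmod z - r)%R. split; [lra|]. exists 0. split; [now rewrite Cmod_0|].
        intros w Hw Hwr. exfalso.
        assert (H := Cmod_triangle w (- (w - z))). rewrite Cmod_opp in H.
        replace (w + - (w - z)) with z in H by ring. lra. }
    intros z. destruct (Hbeat' z) as (d & Hd & y & Hy & Hw).
    (* The compactness theorem covers by squares; a square of half side [d / 2] lies in the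
       disk of radius [d]. *)
    assert (Hd2 : (0 < d / 2)%R) by lra.
    exists (mkposreal _ Hd2), y. split; [exact Hy|]. simpl. intros w H1 H2.
    apply Hw.
    replace (w - z) with (RtoC (Re w - Re z) + RtoC (Im w - Im z) * Ci).
    - eapply Rle_lt_trans; [apply Cmod_triangle|].
      rewrite Cmod_mult, Cmod_Ci, !Cmod_R. lra.
    - destruct w, z. unfold RtoC, Ci, Cplus, Cmult, Cminus, Copp; simpl.
      apply injective_projections; simpl; ring. }
  destruct (choice _ Hbeat) as [delta Hdelta].
  apply (compactness_list 2 (- r, (- r, tt))%R (r, (r, tt))
           (fun x => delta (fst x, fst (snd x)))).
  intros [l Hl].
  assert (Hdom : exists y, (Cmod y <= r)%R /\ forall t, In t l -> forall w,
    (Rabs (Re w - fst t) < delta (fst t, fst (snd t)))%R ->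
    (Rabs (Im w - fst (snd t)) < delta (fst t, fst (snd t)))%R ->
    (Cmod w <= r)%R -> (u w < u y)%R).
  { clear Hl. induction l as [|t l (y & Hy & IH)].
    - exists 0. split; [now rewrite Cmod_0|]. intros t [].
    - destruct (Hdelta (fst t, fst (snd t))) as (y' & Hy' & H').
      destruct (Rle_lt_dec (u y) (u y')) as [Hle|Hlt].
      + exists y'. split; [exact Hy'|]. intros s [<-|Hs] w H1 H2 H3.
        * now apply H'.
        * eapply Rlt_le_trans; [now apply (IH s)|exact Hle].
      + exists y. split; [exact Hy|]. intros s [<-|Hs] w H1 H2 H3.
        * eapply Rlt_trans; [now apply H'|exact Hlt].
        * now apply (IH s). }
  destruct Hdom as (y & Hy & Hdom).
  assert (Hre := Rle_trans _ _ _ (re_le_Cmod y) Hy).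
  assert (Him := Rle_trans _ _ _ (Rle_trans _ _ _ (Rmax_r _ _) (Rmax_Cmod y)) Hy).
  apply Rabs_le_between in Hre. apply Rabs_le_between in Him.
  destruct (Hl (Re y, (Im y, tt))) as ((t1 & t2 & []) & Ht & _ & Hc).
  { simpl. repeat split; unfold Re, Im; tauto. }
  simpl in Hc.
  apply (Rlt_irrefl (u y)). apply (Hdom _ Ht); simpl; tauto.
Qed.

Lemma derive_le_0_of_right_max (phi : R -> R) (L d : R) :
  (0 < d)%R -> is_derive phi 0%R L ->
  (forall t, 0 < t < d -> phi t <= phi 0)%R -> (L <= 0)%R.
Proof.
  intros Hd HL Hmax. apply Rnot_lt_le. intros HL0.
  apply is_derive_Reals in HL. destruct (HL L HL0) as [eta Heta].
  set (h := (Rmin d eta / 2)%R).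
  assert (Hm : (0 < Rmin d eta)%R) by (apply Rmin_glb_lt; [exact Hd|apply cond_pos]).
  assert (H1 := Rmin_l d eta). assert (H2 := Rmin_r d eta).
  assert (Hh : (0 < h < d /\ h < eta)%R) by (unfold h; lra).
  specialize (Heta h). rewrite Rplus_0_l in Heta.
  assert (H := Heta ltac:(lra) ltac:(rewrite Rabs_pos_eq; lra)).
  apply Rabs_lt_between in H.
  assert (Hq : (0 < (phi h - phi 0) / h)%R) by lra.
  apply Rmult_lt_compat_r with (r := h) in Hq; [|lra].
  unfold Rdiv in Hq. rewrite Rmult_assoc, Rinv_l in Hq by lra.
  assert (H3 := Hmax h ltac:(lra)). lra.
Qed.

Lemma second_derive_le_0_of_max (phi psi : R -> R) (L d : R) :
  (0 < d)%R ->
  (forall t, Rabs t < d -> is_derive phi t (psi t))%R ->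
  is_derive psi 0%R L ->
  (forall t, Rabs t < d -> phi t <= phi 0)%R -> (L <= 0)%R.
Proof.
  intros Hd Hphi HL Hmax. apply Rnot_lt_le. intros HL0.
  assert (H0 : psi 0%R = 0%R).
  { assert (Hp : derivable_pt_lim phi 0 (psi 0%R))
      by (apply is_derive_Reals, Hphi; rewrite Rabs_R0; exact Hd).
    assert (pr : derivable_pt phi 0) by (now exists (psi 0%R)).
    rewrite <- (derive_pt_eq_0 _ _ _ pr Hp).
    apply (deriv_maximum phi (- d) d 0 pr); [lra | lra |].
    intros x Hx1 Hx2. apply Hmax. apply Rabs_lt_between. lra. }
  apply is_derive_Reals in HL. destruct (HL L HL0) as [eta Heta].
  set (h := (Rmin d eta / 2)%R).
  assert (Hm : (0 < Rmin d eta)%R) by (apply Rmin_glb_lt; [exact Hd|apply cond_pos]).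
  assert (H1 := Rmin_l d eta). assert (H2 := Rmin_r d eta).
  assert (Hh : (0 < h < d /\ h < eta)%R) by (unfold h; lra).
  destruct (MVT_cor2 phi psi 0 h) as (c & Hc & Hc'); [lra| |].
  { intros c Hc. apply is_derive_Reals, Hphi. rewrite Rabs_pos_eq; lra. }
  specialize (Heta c). rewrite Rplus_0_l, H0, Rminus_0_r in Heta.
  assert (H := Heta ltac:(lra) ltac:(rewrite Rabs_pos_eq; lra)).
  apply Rabs_lt_between in H.
  assert (Hq : (0 < psi c / c)%R) by lra.
  apply Rmult_lt_compat_r with (r := c) in Hq; [|lra].
  unfold Rdiv in Hq. rewrite Rmult_assoc, Rinv_l in Hq by lra.
  assert (H3 := Hmax h ltac:(rewrite Rabs_pos_eq; lra)). nra.
Qed.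

(** For [eps > 0] the added term makes the function strictly subharmonic; [eps = 0] gives the
    maximum of the squared modulus itself. *)
Lemma disk_series_max_Cmod (F : C -> C) (eps r : R) :
  disk_series F -> (0 <= r < 1)%R ->
  exists z0, (Cmod z0 <= r)%R /\ forall w, (Cmod w <= r)%R ->
    (dot (F w) (F w) + eps * dot w w <= dot (F z0) (F z0) + eps * dot z0 z0)%R.
Proof.
  intros HF Hr.
  apply (continuous_closed_disk_max (fun z => dot (F z) (F z) + eps * dot z z)%R); [lra|].
  intros z Hz e He.
  destruct (disk_series_derive F HF) as [_ HD].
  assert (Hzd : unit_disk z) by (unfold unit_disk; lra).
  assert (Hsq : forall x b, (0 < b)%R -> exists d, (0 < d)%R /\ forall y,
    (Cmod (y - x) < d)%R -> (Rabs (dot y y - dot x x) < b)%R).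
  { intros x b Hb. rewrite dot_self.
    assert (Hx := Cmod_ge_0 x).
    exists (Rmin 1 (b / (2 * Cmod x + 1))). split.
    - apply Rmin_glb_lt; [lra|]. apply Rdiv_lt_0_compat; lra.
    - intros y Hy. rewrite dot_self.
      assert (H1 := Rlt_le_trans _ _ _ Hy (Rmin_l _ _)).
      assert (H2 := Rlt_le_trans _ _ _ Hy (Rmin_r _ _)).
      apply Rlt_div_r in H2; [|lra].
      assert (T1 := Cmod_le_add_dist x y).
      assert (T2 := Cmod_triangle y (- (y - x))). replace (y + - (y - x)) with x in T2 by ring.
      rewrite Cmod_opp in T2.
      assert (Hy0 := Cmod_ge_0 y). assert (Hd0 := Cmod_ge_0 (y - x)).
      apply Rabs_lt_between. split; nra. }
  destruct (Hsq (F z) (e / 2)%R) as (d1 & Hd1 & H1); [lra|].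
  destruct (is_derive_C_continuous F z _ (HD z Hzd) d1 Hd1) as (d2 & Hd2 & H2).
  assert (Hab : (0 < Rabs eps + 1)%R) by (generalize (Rabs_pos eps); lra).
  destruct (Hsq z (e / 2 / (Rabs eps + 1))%R) as (d3 & Hd3 & H3);
    [apply Rdiv_lt_0_compat; lra|].
  exists (Rmin d2 d3). split; [now apply Rmin_glb_lt|].
  intros w Hw.
  specialize (H1 _ (H2 w (Rlt_le_trans _ _ _ Hw (Rmin_l _ _)))).
  specialize (H3 w (Rlt_le_trans _ _ _ Hw (Rmin_r _ _))).
  replace (dot (F w) (F w) + eps * dot w w - (dot (F z) (F z) + eps * dot z z))%R
    with ((dot (F w) (F w) - dot (F z) (F z)) + eps * (dot w w - dot z z))%R by ring.
  eapply Rle_lt_trans; [apply Rabs_triang|]. rewrite Rabs_mult.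
  apply Rlt_div_r in H3; [|lra].
  assert (H0 := Rabs_pos (dot w w - dot z z)). nra.
Qed.

(** * Maximum modulus and division by powers of the variable *)

(** The function [|F|^2 + eps |z|^2] has Laplacian [4 |F'|^2 + 4 eps > 0], whereas both second
    derivatives along the axes are nonpositive at a local maximum. *)
Lemma no_interior_max (F : C -> C) (eps : R) (z0 : C) (d : R) :
  disk_series F -> (0 < eps)%R -> unit_disk z0 -> (0 < d)%R ->
  (forall w, (Cmod (w - z0) < d)%R ->
    (dot (F w) (F w) + eps * dot w w <= dot (F z0) (F z0) + eps * dot z0 z0)%R) ->
  False.
Proof.
  intros HF Heps Hz Hd Hmax.
  destruct (disk_series_derive F HF) as [HF1 HD].
  destruct (disk_series_derive _ HF1) as [_ HD1].
  set (F1 := C_derive F) in *. set (F2 := C_derive F1) in *. clearbody F2. clearbody F1.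
  unfold unit_disk in Hz.
  assert (Hdir : forall e, Cmod e = 1%R ->
    (2 * (dot (F1 z0 * e) (F1 z0 * e) + dot (F z0) (F2 z0 * e * e) + eps * dot e e) <= 0)%R).
  { intros e He.
    apply (second_derive_le_0_of_max
      (fun t : R => dot (F (z0 + t * e)%C) (F (z0 + t * e)%C)
                    + eps * dot (z0 + t * e) (z0 + t * e))%R
      (fun t : R => 2 * (dot (F (z0 + t * e)%C) (F1 (z0 + t * e)%C * e)
                    + eps * dot (z0 + t * e) e))%R _ (Rmin d (1 - Cmod z0))%R).
    - apply Rmin_glb_lt; lra.
    - intros t Ht.
      assert (Ht2 := Rlt_le_trans _ _ _ Ht (Rmin_r _ _)).
      assert (Hzt : unit_disk (z0 + t * e)).
      { unfold unit_disk. eapply Rle_lt_trans; [apply Cmod_triangle|].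
        rewrite Cmod_mult, Cmod_R, He. lra. }
      assert (K1 := is_derive_dot_line F F z0 e _ _ t (HD _ Hzt) (HD _ Hzt)).
      assert (K2 := is_derive_dot_line (fun w => w) (fun w => w) z0 e _ _ t
                      (is_derive_C_id _) (is_derive_C_id _)).
      assert (K := is_derive_plus _ _ _ _ _ K1 (is_derive_scal _ _ eps _ K2)).
      match type of K with is_derive _ _ ?x => match goal with |- is_derive _ _ ?y =>
        replace y with x; [exact K|] end end.
      unfold plus; simpl. unfold dot, Re, Im; simpl. ring.
    - assert (Hz0 : unit_disk (z0 + RtoC 0 * e)).
      { replace (z0 + RtoC 0 * e) with z0 by ring. exact Hz. }
      assert (K0 : forall w, unit_disk w ->
        is_C_derive (fun w => F1 w * e) w (F2 w * e)).
      { intros w Hw. apply (is_derive_scal_l F1 w (F2 w) e). now apply is_derive_C_AbsRing, HD1. }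
      assert (K1 := is_derive_dot_line F (fun w => F1 w * e) z0 e _ _ 0%R
                      (HD _ Hz0) (K0 _ Hz0)).
      assert (Kc : is_C_derive (fun _ => e) (z0 + RtoC 0 * e) (RtoC 0))
        by exact (is_derive_const e _).
      assert (K2 := is_derive_dot_line (fun w => w) (fun w => e) z0 e _ _ 0%R
                      (is_derive_C_id _) Kc).
      assert (K := is_derive_scal _ _ 2 _
                     (is_derive_plus _ _ _ _ _ K1 (is_derive_scal _ _ eps _ K2))).
      replace (z0 + RtoC 0 * e) with z0 in K by ring.
      match type of K with is_derive _ _ ?x => match goal with |- is_derive _ _ ?y =>
        replace y with x; [exact K|] end end.
      unfold plus; simpl. unfold dot, Re, Im; simpl. ring.
    - intros t Ht. replace (z0 + RtoC 0 * e) with z0 by ring. apply Hmax.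
      replace (z0 + t * e - z0) with (t * e) by ring.
      rewrite Cmod_mult, Cmod_R, He, Rmult_1_r.
      eapply Rlt_le_trans; [exact Ht|apply Rmin_l]. }
  (* The contributions of [F'' e^2] for [e = 1] and [e = Ci] cancel. *)
  assert (A := Hdir 1 Cmod_1). assert (B := Hdir Ci Cmod_Ci).
  set (x := F z0) in *. set (x1 := F1 z0) in *. set (x2 := F2 z0) in *.
  clearbody x x1 x2. clear - A B Heps. destruct x, x1, x2.
  unfold dot in *; simpl in *. nra.
Qed.

(** If [|F z| > B], the perturbation [eps |z|^2] can be taken so small that the maximum of
    [|F|^2 + eps |z|^2] still exceeds every value on the circle, hence lies inside it. *)
Lemma maximum_modulus (F : C -> C) (r B : R) :
  disk_series F -> (0 <= r < 1)%R ->
  (forall w, Cmod w = r -> (Cmod (F w) <= B)%R) ->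
  forall z, (Cmod z <= r)%R -> (Cmod (F z) <= B)%R.
Proof.
  intros HF Hr HB z Hz. apply Rnot_lt_le. intros Hlt.
  assert (HB0 : (0 <= B)%R).
  { eapply Rle_trans; [apply (Cmod_ge_0 (F r))|]. apply HB.
    rewrite Cmod_R, Rabs_pos_eq; lra. }
  (* Any [eps] below [|F z|^2 - B^2] would do, since [r < 1]. *)
  set (eps := ((Cmod (F z) ^ 2 - B ^ 2) / 2)%R).
  assert (Heps : (0 < eps)%R) by (unfold eps; nra).
  destruct (disk_series_max_Cmod F eps r HF Hr) as (z0 & Hz0 & Hmax).
  destruct (Req_dec (Cmod z0) r) as [He|Hne].
  - specialize (Hmax z Hz). rewrite !dot_self, He in Hmax.
    assert (H := HB z0 He). assert (H0 := Cmod_ge_0 (F z0)). assert (H1 := Cmod_ge_0 z).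
    assert (E : (Cmod (F z) ^ 2 = B ^ 2 + 2 * eps)%R) by (unfold eps; field).
    assert (0 <= Cmod z ^ 2)%R by apply pow2_ge_0.
    assert (r ^ 2 < 1)%R by nra. assert (eps * r ^ 2 < eps * 1)%R by (apply Rmult_lt_compat_l; lra).
    assert (Cmod (F z0) ^ 2 <= B ^ 2)%R by (apply pow_incr; lra).
    assert (0 <= eps * Cmod z ^ 2)%R by (apply Rmult_le_pos; lra). lra.
  - apply (no_interior_max F eps z0 (r - Cmod z0) HF Heps); [unfold unit_disk; lra|lra|].
    intros w Hw. apply Hmax.
    assert (T := Cmod_le_add_dist z0 w). lra.
Qed.

Lemma pow_ge_linear (r : R) (n : nat) : (0 <= r <= 1 -> 1 - INR n * (1 - r) <= r ^ n)%R.
Proof.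
  intros Hr. induction n as [|n IH]; [simpl; lra|].
  rewrite S_INR. simpl pow. assert (H := pos_INR n).
  assert (H1 : (r * (1 - INR n * (1 - r)) <= r * r ^ n)%R) by (apply Rmult_le_compat_l; lra).
  assert (H2 : (0 <= INR n * (1 - r) ^ 2)%R) by (apply Rmult_le_pos; [exact H | apply pow2_ge_0]).
  nra.
Qed.

(** Schwarz's lemma: on the circle of radius [1 - s] the bound is [M / (1 - s) ^ n], the maximum
    principle carries it inside, and [s] tends to [0]. *)
Lemma schwarz_division (F : C -> C) (n : nat) (M : R) :
  disk_series F ->
  (forall z, unit_disk z -> (Cmod z ^ n * Cmod (F z) <= M)%R) ->
  forall z, unit_disk z -> (Cmod (F z) <= M)%R.
Proof.
  intros HF HM z Hz. unfold unit_disk in Hz. apply Rnot_lt_le. intros Hlt.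
  assert (Hz0 := Cmod_ge_0 z). set (A := Cmod (F z)) in *.
  assert (HA : (0 <= A)%R) by apply Cmod_ge_0. assert (Hn := pos_INR n).
  assert (HM0 : (0 <= M)%R).
  { eapply Rle_trans; [|apply (HM z Hz)]. apply Rmult_le_pos; [|apply HA]. apply pow_le, Hz0. }
  (* [(1 - s) ^ n >= 1 - n * s], and the last bound on [s] gives [A * n * s < A - M]. *)
  set (s := Rmin (1 - Cmod z) (Rmin (1 / 2) ((A - M) / (2 * (INR n + 1) * A)))%R).
  assert (Hq : (0 < (A - M) / (2 * (INR n + 1) * A))%R)
    by (apply Rdiv_lt_0_compat; [lra | apply Rmult_lt_0_compat; lra]).
  assert (Hs0 : (0 < s)%R) by (repeat apply Rmin_glb_lt; lra).
  assert (Hs1 : (s <= 1 - Cmod z)%R) by apply Rmin_l.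
  assert (Hs2 : (s <= 1 / 2)%R) by (eapply Rle_trans; [apply Rmin_r|apply Rmin_l]).
  assert (Hs3 : (s <= (A - M) / (2 * (INR n + 1) * A))%R)
    by (eapply Rle_trans; [apply Rmin_r|apply Rmin_r]).
  assert (Hpow := pow_ge_linear (1 - s) n ltac:(lra)).
  set (p := ((1 - s) ^ n)%R) in *.
  assert (Hp : (0 < p)%R) by (apply pow_lt; lra).
  assert (H : (A <= M / p)%R).
  { apply (maximum_modulus F (1 - s) (M / p) HF); [lra| |lra].
    intros w Hw. specialize (HM w). unfold unit_disk in HM. rewrite Hw in HM.
    specialize (HM ltac:(lra)). fold p in HM.
    apply Rle_div_r; [exact Hp|]. lra. }
  apply Rle_div_r in H; [|exact Hp].
  apply Rle_div_r in Hs3; [|apply Rmult_lt_0_compat; lra].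
  assert (H1 : (A * (1 - INR n * s) <= A * p)%R) by (apply Rmult_le_compat_l; lra).
  assert (0 <= A * s)%R by (apply Rmult_le_pos; lra).
  assert (0 <= A * s * INR n)%R by (apply Rmult_le_pos; lra).
  nra.
Qed.

(** * Inverting the Euler operator *)

(** Let [|F|] be maximal at [z0] on a closed disk about the origin. Since [Re g > 0], the direction
    [- Cconj g * z0] points into the disk, so [|F|^2] does not increase along it:
    [Re (Cconj g * z0 * F' z0 * Cconj (F z0)) >= 0]. This is the cross term in
    [|z0 * F' z0 + g * F z0|^2], which is therefore at least [|g * F z0|^2]. The modulus of [g],
    and not only its real part, appears because the direction is adapted to [g]. *)
Lemma euler_operator_bound (F : C -> C) (g : C) (M : R) :
  disk_series F -> (0 < Re g)%R ->
  (forall z, unit_disk z -> (Cmod (z * C_derive F z + g * F z) <= M)%R) ->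
  forall z, unit_disk z -> (Cmod g * Cmod (F z) <= M)%R.
Proof.
  intros HF Hg HM z1 Hz1. unfold unit_disk in Hz1.
  assert (H1 := Cmod_ge_0 z1).
  destruct (disk_series_max_Cmod F 0 (Cmod z1) HF) as (z0 & Hz0 & Hmax); [lra|].
  assert (Hzd : unit_disk z0) by (unfold unit_disk; lra).
  assert (Hcmp : (Cmod (F z1) <= Cmod (F z0))%R).
  { specialize (Hmax z1 (Rle_refl _)). rewrite !dot_self, !Rmult_0_l, !Rplus_0_r in Hmax.
    assert (H2 := Cmod_ge_0 (F z1)). assert (H3 := Cmod_ge_0 (F z0)).
    apply Rnot_lt_le. intros H. nra. }
  destruct (disk_series_derive F HF) as [_ HD].
  set (e := - (Cconj g * z0)).
  assert (Hdir : (dot (C_derive F z0 * e) (F z0) + dot (F z0) (C_derive F z0 * e) <= 0)%R).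
  { assert (Hg2 : (0 < Cmod g ^ 2)%R).
    { rewrite Cmod2_alt. assert (0 <= Im g ^ 2)%R by apply pow2_ge_0. nra. }
    apply (derive_le_0_of_right_max (fun t : R => dot (F (z0 + t * e)) (F (z0 + t * e))) _
             (2 * Re g / Cmod g ^ 2)).
    - apply Rdiv_lt_0_compat; lra.
    - assert (Hzd' : unit_disk (z0 + RtoC 0 * e))
        by (replace (z0 + RtoC 0 * e) with z0 by ring; exact Hzd).
      assert (K := is_derive_dot_line F F z0 e _ _ 0%R (HD _ Hzd') (HD _ Hzd')).
      replace (z0 + RtoC 0 * e) with z0 in K by ring. exact K.
    - intros t Ht. replace (z0 + RtoC 0 * e) with z0 by ring.
      assert (Hin : (Cmod (z0 + t * e) <= Cmod z1)%R).
      { apply Rle_trans with (2 := Hz0).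
        replace (z0 + t * e) with (z0 * (1 - t * Cconj g)) by (unfold e; ring).
        rewrite Cmod_mult.
        assert (Hc : (Cmod (1 - t * Cconj g) <= 1)%R).
        { assert (Ht2 : (t * Cmod g ^ 2 <= 2 * Re g)%R).
          { destruct Ht as [_ Ht]. apply Rmult_lt_compat_r with (r := (Cmod g ^ 2)%R) in Ht; [|lra].
            unfold Rdiv in Ht. rewrite Rmult_assoc, Rinv_l in Ht by lra. lra. }
          rewrite Cmod2_alt in Ht2.
          assert (Hs : (Cmod (1 - t * Cconj g) ^ 2 <= 1)%R).
          { rewrite Cmod2_alt. destruct g as [gx gy]. simpl in *. nra. }
          assert (H2 := Cmod_ge_0 (1 - t * Cconj g)). nra. }
        assert (H2 := Cmod_ge_0 z0). nra. }
      specialize (Hmax _ Hin). rewrite !Rmult_0_l, !Rplus_0_r in Hmax. exact Hmax. }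
  assert (Hkey : (Cmod (g * F z0) <= Cmod (z0 * C_derive F z0 + g * F z0))%R).
  { apply Rsqr_incr_0; try apply Cmod_ge_0. rewrite !Rsqr_pow2, !Cmod2_alt.
    unfold e in Hdir. clear - Hdir.
    set (x := F z0) in *. set (y := C_derive F z0) in *. clearbody x y.
    destruct x, y, z0, g. unfold dot in Hdir; simpl in *. nra. }
  eapply Rle_trans; [|apply (HM z0 Hzd)]. eapply Rle_trans; [|exact Hkey].
  rewrite Cmod_mult. apply Rmult_le_compat_l; [apply Cmod_ge_0|exact Hcmp].
Qed.

(** * From the third derivative to convexity *)

Theorem corollary1 (n : nat) (f : C -> C) (alpha : R) (beta : C)
  (hn : (1 <= n)%nat)
  (hf : class_A n f)
  (halpha : (0 <= alpha < 1)%R)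
  (hbeta : (Re beta < INR n + 1)%R)
  (hbound : forall z : C, unit_disk z ->
     (Cmod (z ^ 2 * C_derive (C_derive (C_derive f)) z
            + (2 - beta) * z * C_derive (C_derive f) z)
      < (1 - alpha) * INR n * Cmod (RtoC (INR n) + 1 - beta)
        / (INR n + 1 - alpha))%R) :
  (forall z : C, unit_disk z ->
     C_derive f z <> 0 /\
     (Cmod ((1 + z * C_derive (C_derive f) z / C_derive f z) - 1)
      < 1 - alpha)%R) /\
  class_K n alpha f.
Proof.
  assert (Hn1 : (1 <= INR n)%R) by (apply (le_INR 1); exact hn).
  set (g := RtoC (INR n) + 1 - beta) in *.
  assert (Hg : (0 < Re g)%R) by (unfold g; destruct beta; simpl in *; lra).
  assert (Hgm : (0 < Cmod g)%R).
  { apply Cmod_gt_0. intros E. rewrite E in Hg. simpl in Hg. lra. }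
  set (N := ((1 - alpha) * INR n / (INR n + 1 - alpha))%R).
  destruct hf as [Hana (a & Ha0 & Ha1 & Hak & Hps)].
  assert (HSf : disk_series f) by (now exists a).
  destruct (disk_series_derive f HSf) as [HSf1 _].
  destruct (disk_series_derive _ HSf1) as [HSf2 _].
  destruct (disk_expansion_derive f a Hps) as [Hps1 _].
  destruct (disk_series_gap _ (coefs_derive a) n hn Hps1) as (p & HSp & Hp).
  { intros k Hk. unfold coefs_derive. rewrite Hak by lia. ring. }
  assert (Hp1 : forall z, unit_disk z -> C_derive f z = 1 + z ^ n * p z).
  { intros z Hz. rewrite (Hp z Hz). unfold coefs_derive. rewrite Ha1. simpl. ring. }
  destruct (disk_series_derive p HSp) as [HSp1 _].
  set (h := fun z => z * C_derive p z + RtoC (INR n) * p z).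
  assert (HSh : disk_series h).
  { apply (disk_series_plus (fun z => z * C_derive p z)).
    - now apply disk_series_id_mult.
    - now apply disk_series_scal. }
  destruct (disk_series_derive h HSh) as [HSh1 _].
  assert (Hf2 : forall z, unit_disk z -> z * C_derive (C_derive f) z = z ^ n * h z)
    by exact (C_derive_monomial_mult _ p 1 n HSp Hp1).
  set (H := fun z => z * C_derive h z + g * h z).
  assert (HSH : disk_series H).
  { apply (disk_series_plus (fun z => z * C_derive h z)).
    - now apply disk_series_id_mult.
    - now apply disk_series_scal. }
  assert (Hexpr : forall z, unit_disk z ->
    z ^ 2 * C_derive (C_derive (C_derive f)) z + (2 - beta) * z * C_derive (C_derive f) z
    = z ^ n * H z).
  { intros z Hz.
    (* The derivative of [w * f'' w] is computed once from [w * f'' w = w ^ n * h w] and once by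
       the product rule. *)
    assert (E1 := C_derive_monomial_mult (fun w => w * C_derive (C_derive f) w) h 0 n HSh
                    ltac:(intros w Hw; cbv beta; rewrite (Hf2 w Hw); simpl; ring) z Hz).
    assert (E2 := C_derive_monomial_mult (fun w => w * C_derive (C_derive f) w)
                    (C_derive (C_derive f)) 0 1 HSf2 ltac:(intros w Hw; simpl; ring) z Hz).
    rewrite E1 in E2. clear E1. assert (E3 := Hf2 z Hz).
    unfold H, g. simpl Cpow in E2. simpl INR in E2.
    transitivity (z * 1 * (z * C_derive (C_derive (C_derive f)) z + 1 * C_derive (C_derive f) z)
                  + (1 - beta) * (z * C_derive (C_derive f) z)); [simpl; ring|].
    rewrite <- E2, E3. ring. }
  assert (HN : (0 < N)%R).
  { unfold N. apply Rdiv_lt_0_compat; [apply Rmult_lt_0_compat|]; lra. }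
  assert (HH : forall z, unit_disk z -> (Cmod (H z) <= N * Cmod g)%R).
  { apply (schwarz_division H n _ HSH). intros z Hz.
    rewrite <- Cmod_pow, <- Cmod_mult, <- Hexpr by exact Hz.
    left. eapply Rlt_le_trans; [apply hbound, Hz|]. right. unfold N. field. lra. }
  assert (Hh : forall z, unit_disk z -> (Cmod (h z) <= N)%R).
  { intros z Hz. assert (B := euler_operator_bound h g _ HSh Hg HH z Hz).
    apply Rmult_le_reg_l with (Cmod g); lra. }
  assert (Hpb : forall z, unit_disk z -> (INR n * Cmod (p z) <= N)%R).
  { intros z Hz. assert (B := euler_operator_bound p (RtoC (INR n)) N HSp).
    rewrite Cmod_R, Rabs_pos_eq in B by lra. apply B; [simpl; lra|exact Hh|exact Hz]. }
  assert (Hmain : forall z, unit_disk z ->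
     C_derive f z <> 0 /\
     (Cmod (z * C_derive (C_derive f) z / C_derive f z) < 1 - alpha)%R).
  { intros z Hz. specialize (Hh z Hz). specialize (Hpb z Hz).
    set (rho := (Cmod z ^ n)%R).
    assert (Hrho : (0 <= rho < 1)%R).
    { unfold rho. split; [apply pow_le, Cmod_ge_0|].
      apply pow_lt_1_compat; [split; [apply Cmod_ge_0|exact Hz]|lia]. }
    assert (HNe : (N * (INR n + 1 - alpha) = (1 - alpha) * INR n)%R) by (unfold N; field; lra).
    assert (HP := Cmod_ge_0 (p z)).
    assert (Hlow : (1 <= Cmod (C_derive f z) + rho * Cmod (p z))%R).
    { rewrite (Hp1 z Hz). unfold rho. rewrite <- Cmod_pow, <- Cmod_mult.
      assert (T := Cmod_triangle (1 + z ^ n * p z) (- (z ^ n * p z))).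
      rewrite Cmod_opp in T.
      replace (1 + z ^ n * p z + - (z ^ n * p z)) with (RtoC 1) in T by ring.
      rewrite Cmod_1 in T. exact T. }
    assert (Hup : (Cmod (z * C_derive (C_derive f) z) <= rho * N)%R).
    { rewrite (Hf2 z Hz), Cmod_mult, Cmod_pow. apply Rmult_le_compat_l; lra. }
    assert (Hlt : (rho * N < (1 - alpha) * Cmod (C_derive f z))%R).
    { assert (B : (rho * (INR n * Cmod (p z)) <= rho * N)%R) by (apply Rmult_le_compat_l; lra).
      assert (B2 : (rho * (N * (INR n + 1 - alpha)) < (1 - alpha) * INR n)%R).
      { rewrite HNe. assert (0 < (1 - alpha) * INR n)%R by (apply Rmult_lt_0_compat; lra).
        apply Rlt_0_minus.
        replace ((1 - alpha) * INR n - rho * ((1 - alpha) * INR n))%R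
          with ((1 - rho) * ((1 - alpha) * INR n))%R by ring.
        apply Rmult_lt_0_compat; lra. }
      apply Rmult_lt_reg_l with (INR n); [lra|].
      assert (B3 : ((1 - alpha) * (INR n * 1) <= (1 - alpha) * (INR n * (Cmod (C_derive f z) + rho * Cmod (p z))))%R).
      { apply Rmult_le_compat_l; [lra|]. apply Rmult_le_compat_l; lra. }
      assert (B4 : ((1 - alpha) * (rho * (INR n * Cmod (p z))) <= (1 - alpha) * (rho * N))%R)
        by (apply Rmult_le_compat_l; lra).
      lra. }
    assert (H0 : (0 <= rho * N)%R) by (apply Rmult_le_pos; lra).
    assert (Hnz : (0 < Cmod (C_derive f z))%R).
    { assert (H1 := Cmod_ge_0 (C_derive f z)).
      destruct H1 as [H1|H1]; [exact H1|]. rewrite <- H1 in Hlt. lra. }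
    split; [now apply Cmod_gt_0|].
    rewrite Cmod_div by (now apply Cmod_gt_0).
    apply Rlt_div_l; [exact Hnz|]. lra. }
  split.
  - intros z Hz. destruct (Hmain z Hz) as [H1 H2]. split; [exact H1|].
    replace (1 + z * C_derive (C_derive f) z / C_derive f z - 1)
      with (z * C_derive (C_derive f) z / C_derive f z) by ring. exact H2.
  - split; [split; [exact Hana|now exists a]|].
    intros z Hz. destruct (Hmain z Hz) as [H1 H2]. split; [exact H1|].
    assert (H3 := re_le_Cmod (z * C_derive (C_derive f) z / C_derive f z)).
    assert (H4 := Rle_lt_trans _ _ _ H3 H2). apply Rabs_lt_between in H4.
    rewrite re_plus. simpl (Re 1). lra.
Qed.
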